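(* Let $\mathcal{K}=(\mathcal{A},g,\{x^1,\dots,x^m\})$ and $\mathcal{K}'=(\mathcal{A}',g',\{y^1,\dots,y^{m'}\})$ be Kähler-Poisson algebras. Then $\mathcal{K}$ and $\mathcal{K}'$ are isomorphic if and only if there exists a Poisson algebra isomorphism $\phi:\mathcal{A}\to\mathcal{A}'$ such that $\phi(\mathcal{A}_{\text{fin}})=\mathcal{A}'_{\text{fin}}$ and $$\mathcal{P}'g'\mathcal{P}'=\mathcal{P}'A^T\phi(g)A\mathcal{P}',$$ where $A=(A^i{}_\alpha)$ is the $m\times m'$ matrix $A^i{}_\alpha=\frac{\partial\phi(x^i)}{\partial y^\alpha}$, $\mathcal{P}'$ is the $m'\times m'$ matrix with entries $(\mathcal{P}')^{\alpha\beta}=\{y^\alpha,y^\beta\}'$, and $\phi(g)=(\phi(g_{ij}))$.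
   Context: Let $\mathbb{K}$ be $\mathbb{R}$ or $\mathbb{C}$. Poisson algebras are commutative associative algebras over $\mathbb{K}$ with a Lie bracket satisfying the Leibniz rule. The bracket of $\mathcal{A}$ is $\{\cdot,\cdot\}$, that of $\mathcal{A}'$ is $\{\cdot,\cdot\}'$. A Kähler-Poisson algebra is a triple $\mathcal{K}=(\mathcal{A},g,\{x^1,\dots,x^m\})$ where $(\mathcal{A},\{\cdot,\cdot\})$ is a Poisson algebra over $\mathbb{K}$, $x^1,\dots,x^m\in\mathcal{A}$, and $g=(g_{ij})$ is a symmetric $m\times m$ matrix with entries in $\mathcal{A}$, such that there exists $\eta\in\mathcal{A}$ with $\sum_{i,j,k,l=1}^m \eta\{a,x^i\}g_{ij}\{x^j,x^k\}g_{kl}\{x^l,b\}=-\{a,b\}$ for all $a,b\in\mathcal{A}$. Its module of derivations is the $\mathcal{A}$-module $\mathfrak{g}=\{a_1\{c^1,\cdot\}+\dots+a_N\{c^N,\cdot\}: a_i,c^i\in\mathcal{A}, N\in\mathbb{N}\}$, a Lie algebra under the commutator bracket. The metric on $\mathfrak{g}$ is $g(\alpha,\beta)=\sum_{i,j}\alpha(x^i)g_{ij}\beta(x^j)$. $\mathcal{A}_{\text{fin}}\subseteq\mathcal{A}$ denotes the subalgebra generated by $x^1,\dots,x^m$, so that its elements are polynomials in $x^1,\dots,x^m$; likewise $\mathcal{A}'_{\text{fin}}$ with $y^1,\dots,y^{m'}$. A morphism $(\phi,\psi):\mathcal{K}\to\mathcal{K}'$ consists of a Poisson algebra homomorphism $\phi:\mathcal{A}\to\mathcal{A}'$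 and a Lie algebra homomorphism $\psi:\mathfrak{g}\to\mathfrak{g}'$ such that for all $a\in\mathcal{A}$, $\alpha,\beta\in\mathfrak{g}$: (1) $\psi(a\alpha)=\phi(a)\psi(\alpha)$; (2) $\phi(\alpha(a))=\psi(\alpha)(\phi(a))$; (3) $\phi(g(\alpha,\beta))=g'(\psi(\alpha),\psi(\beta))$; (4) $\phi(\mathcal{A}_{\text{fin}})\subseteq\mathcal{A}'_{\text{fin}}$. An isomorphism is a morphism $(\phi,\psi)$ such that $\phi$ is a Poisson algebra isomorphism and $\phi(\mathcal{A}_{\text{fin}})=\mathcal{A}'_{\text{fin}}$; $\mathcal{K}$ and $\mathcal{K}'$ are isomorphic if an isomorphism exists. Formal derivatives: since $\phi(x^i)\in\mathcal{A}'_{\text{fin}}$, it can be written as a polynomial in $y^1,\dots,y^{m'}$; $\frac{\partial\phi(x^i)}{\partial y^\alpha}$ denotes the formal partial derivative of such a polynomial representative, evaluated in $\mathcal{A}'$. By itself this may depend on the chosen representative, but the combinations $A\mathcal{P}'$ and $\mathcal{P}'A^T$ (hence both sides of the displayed identity) do not, since $\sum_\alpha A^i{}_\alpha\{y^\alpha,b\}'=\{\phi(x^i),b\}'$ for every $b\in\mathcal{A}'$. *)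

(* Defs.v *)
From HB Require Import structures.
From mathcomp Require Import all_boot all_order all_algebra.
From mathcomp Require Import boolp classical_sets functions reals.
From mathcomp Require Import complex.
From mathcomp Require Import mpoly ring.

Set Implicit Arguments.
Unset Strict Implicit.
Unset Printing Implicit Defensive.

Import GRing.Theory.
Local Open Scope classical_set_scope.
Local Open Scope ring_scope.

(* A realType is a complete archimedean ordered field, i.e. a copy of the
   field of real numbers; R[i] is its complexification. *)
Variant real_or_complex : fieldType -> Prop :=
  | RealScalars (R : realType) : real_or_complex R
  | ComplexScalars (R : realType) : real_or_complex R[i].

(* Algebras are unital: the formal derivatives of polynomials are evaluated
   in the algebra, which requires its unit. *)
HB.mixin Record isPoisson (K : fieldType) A of GRing.ComAlgebra K A := {
  pbracket : A -> A -> A;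
  pbracket_linearl : forall b : A, linear (fun a => pbracket a b);
  pbracket_linearr : forall a : A, linear (pbracket a);
  pbracketxx : forall a : A, pbracket a a = 0;
  pbracket_jacobi : forall a b c : A,
    pbracket a (pbracket b c) + pbracket b (pbracket c a)
      + pbracket c (pbracket a b) = 0;
  pbracketMr : forall a b c : A,
    pbracket a (b * c) = pbracket a b * c + b * pbracket a c
}.

#[short(type="poissonAlgType")]
HB.structure Definition PoissonAlgebra (K : fieldType) :=
  {A of isPoisson K A & GRing.ComAlgebra K A}.

Notation "⦃ a , b ⦄" := (pbracket a b)
  (at level 0, a, b at level 99, format "⦃ a ,  b ⦄") : ring_scope.

Section PoissonTheory.
Variables (K : fieldType) (A : poissonAlgType K).
Implicit Types a b c : A.

HB.instance Definition _ a :=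
  GRing.isLinear.Build K A A *:%R (pbracket a) (pbracket_linearr a).

Lemma pbracketDl a b c : ⦃a + b, c⦄ = ⦃a, c⦄ + ⦃b, c⦄.
Proof. by have := pbracket_linearl c 1 a b; rewrite !scale1r. Qed.

Lemma pbracketC a b : ⦃a, b⦄ = - ⦃b, a⦄.
Proof.
have := pbracketxx (a + b).
rewrite pbracketDl !raddfD /= !pbracketxx add0r addr0 => /eqP.
by rewrite addr_eq0 => /eqP.
Qed.

Lemma pbracket_comm a b c :
  ⦃a, ⦃b, c⦄⦄ - ⦃b, ⦃a, c⦄⦄ = ⦃⦃a, b⦄, c⦄.
Proof.
rewrite (pbracketC a c) raddfN opprK [RHS]pbracketC.
by apply/eqP; rewrite -addr_eq0 pbracket_jacobi.
Qed.

Lemma pbracketr1 a : ⦃a, 1⦄ = 0.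
Proof.
have := pbracketMr a 1 1; rewrite !mulr1 mul1r => /eqP.
by rewrite -{1}[⦃a, 1⦄]addr0 (inj_eq (addrI _)) eq_sym => /eqP.
Qed.
End PoissonTheory.

Section Derivations.
Variables (K : fieldType) (A : poissonAlgType K).

(* a_1 {c^1, .} + ... + a_N {c^N, .} for s = [:: (a_1, c^1); ...; (a_N, c^N)].
   The codomain A^o makes the functions A -> A^o an A-module. *)
Definition hamsum (s : seq (A * A)) : A -> A^o :=
  fun f => \sum_(p <- s) p.1 * ⦃p.2, f⦄.

Definition hamsums : {pred A -> A^o} :=
  [pred f | `[< exists s, f = hamsum s >]].

Lemma hamsumsP (f : A -> A^o) : reflect (exists s, f = hamsum s) (f \in hamsums).
Proof. exact: asboolP. Qed.

Lemma hamsum_cat s t : hamsum (s ++ t) = hamsum s + hamsum t.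
Proof. by apply/funext => f; rewrite /hamsum big_cat. Qed.

Lemma hamsums_submod : submod_closed hamsums.
Proof.
split; first by apply/hamsumsP; exists [::]; apply/funext => f; rewrite /hamsum big_nil.
move=> a u v /hamsumsP[s ->] /hamsumsP[t ->]; apply/hamsumsP.
exists ([seq (a * p.1, p.2) | p <- s] ++ t); rewrite hamsum_cat; congr (_ + _).
apply/funext => f; rewrite /hamsum big_map [LHS]mulr_sumr.
by apply: eq_bigr => p _; rewrite mulrA.
Qed.

HB.instance Definition _ :=
  GRing.isSubmodClosed.Build A (A -> A^o) hamsums hamsums_submod.

Record der := Der { der_fun :> A -> A^o; _ : der_fun \in hamsums }.

HB.instance Definition _ := [isSub for der_fun].
HB.instance Definition _ := [Choice of der by <:].
HB.instance Definition _ := [SubChoice_isSubLmodule of der by <:].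

Lemma hamsumD s f g : hamsum s (f + g) = hamsum s f + hamsum s g.
Proof.
by rewrite /hamsum -big_split; apply: eq_bigr => p _; rewrite raddfD mulrDr.
Qed.

Definition commf (u v : A -> A^o) : A -> A^o := fun f => u (v f) - v (u f).

Lemma commf_subproof (u v : der) : commf u v \in hamsums.
Proof.
case: u v => _ /= /hamsumsP[s ->] [_ /= /hamsumsP[t ->]].
have commDl w1 w2 s' : commf (hamsum (w1 ++ w2)) (hamsum s') =
    commf (hamsum w1) (hamsum s') + commf (hamsum w2) (hamsum s').
  by apply/funext => f; rewrite hamsum_cat /commf !fctE hamsumD opprD addrACA.
have commC w w' : commf (hamsum w) (hamsum w') = - commf (hamsum w') (hamsum w).
  by apply/funext => f; rewrite /commf !fctE opprB.
have comm0 w : commf (hamsum [::]) (hamsum w) = 0.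
  apply: (addrI (commf (hamsum [::]) (hamsum w))).
  by rewrite -commDl addr0.
elim: s => [|[a c] s IHs]; first by rewrite comm0 rpred0.
rewrite -cat1s commDl rpredD // commC rpredN.
elim: t {IHs} => [|[b d] t IHt]; first by rewrite comm0 rpred0.
rewrite -cat1s commDl rpredD //; apply/hamsumsP.
exists [:: (b * ⦃d, a⦄, c); (- (a * ⦃c, b⦄), d); (b * a, ⦃d, c⦄)].
apply/funext => f; rewrite /commf /hamsum !big_cons !big_nil /=.
rewrite -pbracket_comm !addr0 !pbracketMr.
set x := ⦃d, ⦃c, f⦄⦄; set y := ⦃c, ⦃d, f⦄⦄.
ring.
Qed.

Definition der_bracket (u v : der) : der := Der (commf_subproof u v).

End Derivations.

Arguments der {K} A.

Record kaehlerPoisson (K : fieldType) := KaehlerPoisson {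
  kp_alg :> poissonAlgType K;
  kp_dim : nat;
  kp_gen : 'I_kp_dim -> kp_alg;
  kp_metric : 'M[kp_alg]_kp_dim;
  kp_metric_sym : kp_metric^T = kp_metric;
  kp_axiom : exists eta : kp_alg, forall a b : kp_alg,
    \sum_i \sum_j \sum_k \sum_l
      eta * ⦃a, kp_gen i⦄ * kp_metric i j * ⦃kp_gen j, kp_gen k⦄
        * kp_metric k l * ⦃kp_gen l, b⦄
    = - ⦃a, b⦄
}.

Arguments kp_gen {K} k i.

Section KaehlerPoisson.
Variables (K : fieldType) (X : kaehlerPoisson K).

Definition kp_fin : set X :=
  [set a | forall S : {pred X}, GRing.subalg_closed S ->
    (forall i : 'I_(kp_dim X), kp_gen X i \in S) -> a \in S].

Definition der_metric (u v : der X) : X :=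
  \sum_i \sum_j u (kp_gen X i) * kp_metric X i j * v (kp_gen X j).

Definition poisson_mx : 'M[X]_(kp_dim X) :=
  \matrix_(i, j) ⦃kp_gen X i, kp_gen X j⦄.

Definition kp_eval (p : {mpoly K[kp_dim X]}) : X :=
  mmap (in_alg X) (kp_gen X) p.

End KaehlerPoisson.

Arguments kp_fin {K} X.
Arguments poisson_mx {K} X.

Section Morphisms.
Variables (K : fieldType) (X Y : kaehlerPoisson K).

Definition poisson_morphism (phi : {lrmorphism X -> Y}) : Prop :=
  forall a b : X, phi ⦃a, b⦄ = ⦃phi a, phi b⦄.

Definition poisson_isomorphism (phi : {lrmorphism X -> Y}) : Prop :=
  poisson_morphism phi /\ bijective phi.

(* The scalar c : K acts on derivations as c%:A. *)
Definition der_lie_morphism (psi : der X -> der Y) : Prop :=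
  (forall (c : K) (u v : der X),
     psi (c%:A *: u + v) = c%:A *: psi u + psi v) /\
  (forall u v : der X, psi (der_bracket u v) = der_bracket (psi u) (psi v)).

Record kp_morphism (phi : {lrmorphism X -> Y}) (psi : der X -> der Y) : Prop :=
  KPMorphism {
    kpm_poisson : poisson_morphism phi;
    kpm_lie : der_lie_morphism psi;
    kpm_scale : forall (a : X) (u : der X), psi (a *: u) = phi a *: psi u;
    kpm_apply : forall (a : X) (u : der X), phi (u a) = psi u (phi a);
    kpm_metric : forall u v : der X,
      phi (der_metric u v) = der_metric (psi u) (psi v);
    kpm_fin : phi @` kp_fin X `<=` kp_fin Y
  }.

Definition kp_isomorphism (phi : {lrmorphism X -> Y}) (psi : der X -> der Y) :
    Prop :=
  [/\ kp_morphism phi psi, poisson_isomorphism phi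
     & phi @` kp_fin X = kp_fin Y].

Definition kp_isomorphic : Prop := exists phi psi, kp_isomorphism phi psi.

(* B is the matrix of formal partial derivatives of some polynomial
   representatives p i of the elements phi (kp_gen X i).  B depends on the
   choice of p, but B *m poisson_mx Y does not: see jacobian_poisson_mx. *)
Definition is_jacobian (phi : X -> Y) (B : 'M[Y]_(kp_dim X, kp_dim Y)) : Prop :=
  exists p : 'I_(kp_dim X) -> {mpoly K[kp_dim Y]},
    (forall i, kp_eval (p i) = phi (kp_gen X i)) /\
    B = \matrix_(i, j) kp_eval (mderiv j (p i)).

End Morphisms.

Section Jacobian.
Variables (K : fieldType) (X Y : kaehlerPoisson K).

Lemma kp_eval_pbracket (p : {mpoly K[kp_dim Y]}) (b : Y) :
  \sum_j kp_eval (mderiv j p) * ⦃kp_gen Y j, b⦄ = ⦃kp_eval p, b⦄.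
Proof.
have evE : kp_eval (X:=Y) = mmap (in_alg Y) (kp_gen Y) by [].
have bD (a c : Y) : ⦃a + c, b⦄ = ⦃a, b⦄ + ⦃c, b⦄ by exact: pbracketDl.
have bZ c (a : Y) : ⦃c *: a, b⦄ = c *: ⦃a, b⦄.
  by rewrite pbracketC linearZ -scalerN -pbracketC.
pose P q := \sum_j kp_eval (mderiv j q) * ⦃kp_gen Y j, b⦄ = ⦃kp_eval q, b⦄.
have P1 : P 1.
  rewrite /P evE rmorph1 pbracketC pbracketr1 oppr0 big1 // => j _.
  by rewrite -mpolyC1 mderivC rmorph0 mul0r.
have PM q r : P q -> P r -> P (q * r).
  rewrite /P evE rmorphM => Pq Pr.
  rewrite [RHS]pbracketC pbracketMr opprD -mulNr -mulrN -!pbracketC -Pq -Pr.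
  rewrite mulr_suml mulr_sumr -big_split; apply: eq_bigr => j _.
  rewrite mderivM rmorphD !rmorphM /=; ring.
have PX m : P 'X_[m].
  rewrite mpolyXE_id; elim/big_ind: _ => // i _.
  elim: (m i) => [|n IHn]; rewrite ?expr0 // exprS; apply: PM => //.
  rewrite /P (bigD1 i) //= big1 => [|j ji].
    rewrite mderivX mnm1E eqxx scale1r (_ : (U_(i) - U_(i))%MM = 0%MM).
      by rewrite mpolyX0 evE rmorph1 mmapX mmap1U mul1r addr0.
    by apply/mnmP => k; rewrite mnmBE subnn mnm0E.
  by rewrite mderivX mnm1E eq_sym (negPf ji) scale0r evE rmorph0 mul0r.
elim/mpolyind: p => [|c m q _ _ IHq].
  rewrite evE rmorph0 pbracketC raddf0 oppr0 big1 // => j _.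
  by rewrite raddf0 rmorph0 mul0r.
have evD : {morph kp_eval (X:=Y) : u v / u + v}.
  by rewrite evE => u v; rewrite rmorphD.
have evZ e u : kp_eval (X:=Y) (e *: u) = e *: kp_eval u.
  by rewrite evE (mmapZ _ (in_alg Y)) mulr_algl.
rewrite evD evZ bD bZ -PX -IHq scaler_sumr -big_split.
by apply: eq_bigr => j _; rewrite mderivD mderivZ evD evZ mulrDl scalerAl.
Qed.

Lemma jacobian_poisson_mx (phi : X -> Y) B B' :
  is_jacobian phi B -> is_jacobian phi B' ->
  B *m poisson_mx Y = B' *m poisson_mx Y.
Proof.
have jacE C : is_jacobian phi C ->
    C *m poisson_mx Y = \matrix_(i, k) ⦃phi (kp_gen X i), kp_gen Y k⦄.
  move=> [p [pE ->]]; apply/matrixP => i k; rewrite !mxE -pE -kp_eval_pbracket.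
  by apply: eq_bigr => j _; rewrite !mxE.
by move=> /jacE -> /jacE ->.
Qed.

End Jacobian.

(* Main.v *)
Require Import Defs.
From mathcomp Require Import all_boot all_order all_algebra.
From mathcomp Require Import boolp classical_sets.
From mathcomp Require Import mpoly.

Set Implicit Arguments.
Unset Strict Implicit.
Unset Printing Implicit Defensive.

Import GRing.Theory.
Local Open Scope classical_set_scope.
Local Open Scope ring_scope.

(** An isomorphism [phi] of Poisson algebras leaves no choice for the map on
    derivations: the condition [phi (u a) = psi u (phi a)] forces [psi] to be
    the conjugation [u |-> phi \o u \o phi^-1].  Conjugation always sends
    Hamiltonian sums to Hamiltonian sums, and it respects brackets and scalars.
    So the only real content of an isomorphism, besides [phi] itself, is that
    conjugation is an isometry.

    The metric sees a derivation [v] of [Y] only through its row of values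
    [r v] on the generators [y^j] ([der_row]), and
    [g'(v, w) = r v * g' * (r w)^T].  By the chain rule [der_chain], the row of
    values of [v] on the elements [phi (x^i)] is [r v * A^T], whence
    [phi (g(u, v)) = r (psi u) * A^T * phi g * A * (r (psi v))^T].
    Conjugation is therefore an isometry iff the two forms [g'] and
    [A^T * phi g * A] agree on all rows [r v], where [v] ranges over the
    derivations of [Y] (conjugation is onto).

    These rows are exactly the linear combinations of the rows of the Poisson
    matrix [P']: the row of [{y^i, .}] is the [i]th row of [P'], and conversely
    the Kaehler-Poisson axiom writes every [{a, .}], hence every derivation, as
    a combination of the [{y^l, .}] ([der_row_sub]).  Since [P'] is
    antisymmetric, agreement on the rows of [P'] is the stated matrix
    identity. *)

(** * Derivations of a Kaehler-Poisson algebra in terms of the generators *)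

Lemma hamsumE (K : fieldType) (A : poissonAlgType K) (u : der A) :
  exists s, forall a, u a = \sum_(p <- s) p.1 * ⦃p.2, a⦄.
Proof. by case: u => f /= /hamsumsP[s ->]; exists s. Qed.

Lemma ham_subproof (K : fieldType) (A : poissonAlgType K) (c : A) :
  (pbracket c : A -> A^o) \in hamsums (A := A).
Proof.
apply/hamsumsP; exists [:: (1, c)]; apply/funext => b.
by rewrite /hamsum big_seq1 mul1r.
Qed.

Definition ham (K : fieldType) (A : poissonAlgType K) (c : A) : der A :=
  Der (ham_subproof c).

Section Generators.
Variables (K : fieldType) (X : kaehlerPoisson K).
Implicit Types u v : der X.

Definition der_row u : 'rV[X]_(kp_dim X) := \row_j (u (kp_gen X j) : X).

Lemma der_row_ham i : der_row (ham (kp_gen X i)) = row i (poisson_mx X).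
Proof. by apply/rowP => j; rewrite !mxE. Qed.

Lemma poisson_mx_tr : (poisson_mx X)^T = - poisson_mx X.
Proof. by apply/matrixP => i j; rewrite !mxE pbracketC. Qed.

Lemma bilinear_mxE m n (r : 'rV[X]_m) (M : 'M[X]_(m, n)) (s : 'rV[X]_n) :
  (r *m M *m s^T) 0 0 = \sum_i \sum_j r 0 i * M i j * s 0 j.
Proof.
rewrite exchange_big mxE; apply: eq_bigr => j _.
by rewrite !mxE mulr_suml.
Qed.

Lemma der_metricE u v :
  der_metric u v = (der_row u *m kp_metric X *m (der_row v)^T) 0 0.
Proof.
rewrite bilinear_mxE; apply: eq_bigr => i _; apply: eq_bigr => j _.
by rewrite !mxE.
Qed.

(** The chain rule for Hamiltonian fields passes to their combinations. *)
Lemma der_chain u (p : {mpoly K[kp_dim X]}) :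
  u (kp_eval p) = \sum_j u (kp_gen X j) * kp_eval (mderiv j p) :> X.
Proof.
have [s uE] := hamsumE u; rewrite uE.
under [RHS]eq_bigr => j _ do rewrite uE mulr_suml.
rewrite exchange_big; apply: eq_bigr => -[a c] _ /=.
rewrite pbracketC -kp_eval_pbracket -sumrN mulr_sumr; apply: eq_bigr => j _.
by rewrite -mulrN -pbracketC -mulrA [in RHS](mulrC _ (kp_eval _)).
Qed.

(** The defining axiom, read with [b] free, expresses [{a, .}] through the
    fields [{x^l, .}]; the coefficients are what stands left of [{x^l, b}]. *)
Lemma pbracket_span (a : X) :
  exists w : 'rV[X]_(kp_dim X),
    forall b, ⦃a, b⦄ = \sum_l w 0 l * ⦃kp_gen X l, b⦄.
Proof.
have [eta etaE] := kp_axiom X.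
exists (\row_l - \sum_i \sum_j \sum_k
  eta * ⦃a, kp_gen X i⦄ * kp_metric X i j * ⦃kp_gen X j, kp_gen X k⦄
    * kp_metric X k l) => b.
rewrite -[LHS]opprK -etaE.
under [RHS]eq_bigr => l _ do rewrite mxE mulNr mulr_suml.
rewrite sumrN; congr (- _); rewrite [RHS]exchange_big; apply: eq_bigr => i _.
under [RHS]eq_bigr => l _ do rewrite mulr_suml.
rewrite [RHS]exchange_big; apply: eq_bigr => j _.
under [RHS]eq_bigr => l _ do rewrite mulr_suml.
by rewrite [RHS]exchange_big.
Qed.

Lemma der_row_sub u : exists w, der_row u = w *m poisson_mx X.
Proof.
have [s uE] := hamsumE u.
suff [w wE] : exists w : 'rV[X]_(kp_dim X), forall b,
    \sum_(p <- s) p.1 * ⦃p.2, b⦄ = \sum_l w 0 l * ⦃kp_gen X l, b⦄.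
  exists w; apply/rowP => j; rewrite !mxE uE wE.
  by apply: eq_bigr => l _; rewrite mxE.
elim: s {uE} => [|[a c] s [w wE]].
  by exists 0 => b; rewrite big_nil big1 // => l _; rewrite mxE mul0r.
have [z zE] := pbracket_span c; exists (a *: z + w) => b.
rewrite big_cons wE zE mulr_sumr -big_split; apply: eq_bigr => l _ /=.
by rewrite !mxE mulrDl mulrA.
Qed.

(** Since the rows of derivations and the rows of the Poisson matrix have the
    same span, bilinear forms need only be compared on the latter.  Antisymmetry
    replaces the transposed right factor by the Poisson matrix itself, at the
    cost of a sign common to both sides. *)
Lemma der_row_form_eq (M N : 'M[X]_(kp_dim X)) :
  poisson_mx X *m M *m poisson_mx X = poisson_mx X *m N *m poisson_mx X <->
  (forall u v, (der_row u *m M *m (der_row v)^T) 0 0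
             = (der_row u *m N *m (der_row v)^T) 0 0).
Proof.
split=> [PMP u v | MN].
  have [[w ->] [z ->]] := (der_row_sub u, der_row_sub v).
  rewrite trmx_mul poisson_mx_tr mulNmx !mulmxN !mulmxA.
  by rewrite -!(mulmxA w) PMP.
suff : poisson_mx X *m M *m (poisson_mx X)^T
     = poisson_mx X *m N *m (poisson_mx X)^T.
  by rewrite poisson_mx_tr !mulmxN => /oppr_inj.
have entryE (B : 'M[X]_(kp_dim X)) i j :
    (poisson_mx X *m B *m (poisson_mx X)^T) i j
  = (row i (poisson_mx X) *m B *m (row j (poisson_mx X))^T) 0 0.
  by rewrite -row_mul !mxE; apply: eq_bigr => k _; rewrite !mxE.
by apply/matrixP => i j; rewrite !entryE -!der_row_ham.
Qed.

(** The values of polynomials at the generators form a subalgebra, so the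
    smallest subalgebra containing the generators consists of such values. *)
Lemma kp_finP (a : X) : kp_fin X a -> exists p, kp_eval p = a.
Proof.
pose S : {pred X} := [pred a | `[< exists p, kp_eval p = a >]].
move=> /(_ S) fina; suff : a \in S by move=> /asboolP.
apply: fina => [|i]; last first.
  by apply/asboolP; exists 'X_i; rewrite /kp_eval mmapX mmap1U.
split=> [|c u v /asboolP[p <-] /asboolP[q <-]
         |u v /asboolP[p <-] /asboolP[q <-]]; apply/asboolP.
- by exists 1; rewrite /kp_eval rmorph1.
- exists (c *: p + q); rewrite /kp_eval rmorphD /=.
  by rewrite (mmapZ _ (in_alg X)) mulr_algl.
- by exists (p * q); rewrite /kp_eval rmorphM.
Qed.

Lemma kp_fin_gen i : kp_fin X (kp_gen X i).
Proof. by move=> S _ /(_ i). Qed.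

End Generators.

(** * Transport of derivations along a Poisson isomorphism *)

Section Transport.
Variables (K : fieldType) (X Y : kaehlerPoisson K) (phi : {lrmorphism X -> Y}).

Lemma jacobian_exists :
  phi @` kp_fin X `<=` kp_fin Y ->
  exists A : 'M[Y]_(kp_dim X, kp_dim Y), is_jacobian phi A.
Proof.
move=> phi_fin.
have /choice[p pE] i : exists p, kp_eval p = phi (kp_gen X i).
  by apply/kp_finP/phi_fin; exists (kp_gen X i) => //; apply: kp_fin_gen.
by exists (\matrix_(i, j) kp_eval (mderiv j (p i))); exists p.
Qed.

Lemma der_row_jacobian (A : 'M[Y]_(kp_dim X, kp_dim Y)) (v : der Y) :
  is_jacobian phi A ->
  \row_i (v (phi (kp_gen X i)) : Y) = der_row v *m A^T.
Proof.
move=> [p [pE ->]]; apply/rowP => i; rewrite !mxE -pE der_chain.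
by apply: eq_bigr => j _; rewrite !mxE.
Qed.

(** Only compatibility of [u] and [u'] with [phi] enters, so this serves for an
    arbitrary morphism as well as for conjugation. *)
Lemma der_metric_jacobian A (u v : der X) (u' v' : der Y) :
  is_jacobian phi A ->
  (forall a, phi (u a) = u' (phi a)) -> (forall a, phi (v a) = v' (phi a)) ->
  phi (der_metric u v) =
    (der_row u' *m (A^T *m map_mx phi (kp_metric X) *m A) *m (der_row v')^T) 0 0.
Proof.
move=> jacA uE vE.
have -> : der_row u' *m (A^T *m map_mx phi (kp_metric X) *m A) *m (der_row v')^T
    = (der_row u' *m A^T) *m map_mx phi (kp_metric X) *m (der_row v' *m A^T)^T.
  by rewrite trmx_mul trmxK !mulmxA.
rewrite -!der_row_jacobian // der_metricE !bilinear_mxE rmorph_sum.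
apply: eq_bigr => i _; rewrite rmorph_sum; apply: eq_bigr => j _.
by rewrite !rmorphM !mxE /= uE vE.
Qed.

Hypothesis phiP : poisson_morphism phi.

Section Conjugation.
Variable f : Y -> X.
Hypotheses (phiK : cancel phi f) (fK : cancel f phi).

(** Bracket preservation turns the conjugate of [a {c, .}] into
    [phi a {phi c, .}], so the conjugate is again a Hamiltonian sum. *)
Lemma conj_der_subproof (u : der X) :
  (fun b => phi (u (f b)) : Y^o) \in hamsums (A := Y).
Proof.
have [s uE] := hamsumE u; apply/hamsumsP.
exists [seq (phi p.1, phi p.2) | p <- s]; apply/funext => b.
rewrite uE /hamsum big_map rmorph_sum; apply: eq_bigr => p _.
by rewrite rmorphM /= phiP !fK.
Qed.

Definition conj_der (u : der X) : der Y := Der (conj_der_subproof u).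

Lemma conj_derE (u : der X) a : phi (u a) = conj_der u (phi a).
Proof. by rewrite /= phiK. Qed.

Lemma conj_derZD (a : X) (u v : der X) :
  conj_der (a *: u + v) = phi a *: conj_der u + conj_der v.
Proof.
by apply/val_inj/funext => b; rewrite /= /GRing.scale /= rmorphD rmorphM.
Qed.

Lemma conj_der_bracket (u v : der X) :
  conj_der (der_bracket u v) = der_bracket (conj_der u) (conj_der v).
Proof.
by apply/val_inj/funext => b; rewrite /= /commf /= !phiK rmorphB.
Qed.

Lemma conj_der_morphism :
  phi @` kp_fin X `<=` kp_fin Y ->
  (forall u v, phi (der_metric u v) = der_metric (conj_der u) (conj_der v)) ->
  kp_morphism phi conj_der.
Proof.
move=> phi_fin phi_metric; split=> //.
- split=> [c u v|]; last exact: conj_der_bracket.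
  by rewrite conj_derZD linearZ rmorph1.
- move=> a u; apply/val_inj/funext => b.
  by rewrite /= /GRing.scale /= rmorphM.
- by move=> a u; rewrite conj_derE.
Qed.

End Conjugation.

(** This is surjectivity of conjugation, stated without naming the inverse of
    [phi]: it lets the isometry condition on the derivations of [X] say something
    about every derivation of [Y]. *)
Lemma der_lift : bijective phi ->
  forall v : der Y, exists u : der X, forall a, phi (u a) = v (phi a).
Proof.
move=> [f phiK fK] v; have [s vE] := hamsumE v.
have uP : hamsum [seq (f p.1, f p.2) | p <- s] \in hamsums (A := X).
  by apply/hamsumsP; eexists.
exists (Der uP) => a; rewrite vE /= /hamsum big_map rmorph_sum.
by apply: eq_bigr => p _; rewrite rmorphM /= phiP !fK.
Qed.

End Transport.

(** * The characterization of isomorphic algebras *)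

Theorem proposition3p9 (K : fieldType) (hK : real_or_complex K)
    (X Y : kaehlerPoisson K) :
  kp_isomorphic X Y <->
  exists phi : {lrmorphism X -> Y},
    [/\ poisson_isomorphism phi,
        phi @` kp_fin X = kp_fin Y
      & exists2 A : 'M[Y]_(kp_dim X, kp_dim Y), is_jacobian phi A &
          poisson_mx Y *m kp_metric Y *m poisson_mx Y =
          poisson_mx Y *m A^T *m map_mx phi (kp_metric X) *m A
            *m poisson_mx Y].
Proof.
have assoc (P : 'M[Y]_(kp_dim Y)) A (B : 'M[Y]_(kp_dim X)) :
    P *m A^T *m B *m A *m P = P *m (A^T *m B *m A) *m P.
  by rewrite !mulmxA.
split=> [[phi [psi [morph [phiP phi_bij] fin_eq]]] |].
  exists phi; split=> //.
  have [A jacA] := jacobian_exists (kpm_fin morph).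
  exists A => //; rewrite assoc; apply/der_row_form_eq => u' v'.
  have [[u uE] [v vE]] := (der_lift phiP phi_bij u', der_lift phiP phi_bij v').
  (* Compatibility with the surjective [phi] determines [psi]. *)
  have psi_lift (w : der X) (w' : der Y) : (forall a, phi (w a) = w' (phi a)) -> psi w = w'.
    move=> wE; apply/val_inj/funext => b /=; have [f _ fK] := phi_bij.
    by rewrite -(fK b) -(kpm_apply morph) wE.
  rewrite -der_metricE -(der_metric_jacobian jacA uE vE) (kpm_metric morph).
  by rewrite (psi_lift u u' uE) (psi_lift v v' vE).
move=> [phi [[phiP phi_bij] fin_eq [A jacA]]].
rewrite assoc => /der_row_form_eq forms_eq.
have [f phiK fK] := phi_bij.
exists phi, (conj_der phiP fK); split=> //.
apply: conj_der_morphism => // [|u v]; first by rewrite fin_eq.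
have cE := conj_derE phiP phiK fK.
by rewrite (der_metric_jacobian jacA (cE u) (cE v)) -forms_eq -der_metricE.
Qed.
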